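(* Let $d_x\ge 1$, let $\Omega\subset\mathbb{R}^{d_x}$ be compact, and let $T>0$. For any continuous sigmoidal function $\sigma:\mathbb{R}\to\mathbb{R}$, the finite sums $$G_S(\boldsymbol{x},t)=\sum_{j=1}^{N}u_j\,\sigma\big((\boldsymbol{k}_j^{x})^\top\boldsymbol{x}+b_j^{x}\big)\,\sigma\big(k_j^{t}t+b_j^{t}\big),\qquad N\in\mathbb{N}^+,\ u_j,k_j^t,b_j^x,b_j^t\in\mathbb{R},\ \boldsymbol{k}_j^x\in\mathbb{R}^{d_x},$$ are dense in $C(\Omega\times[0,T])$ (with respect to the supremum norm).
   Context: A function $\sigma:\mathbb{R}\to\mathbb{R}$ is called sigmoidal if $\sigma(z)\to 1$ as $z\to+\infty$ and $\sigma(z)\to 0$ as $z\to-\infty$. $C(\Omega\times[0,T])$ is the space of real-valued continuous functions with the supremum norm. *)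

(* Defs.v *)
From HB Require Import structures.
From mathcomp Require Import all_boot all_order all_algebra.
From mathcomp Require Import all_classical all_reals all_analysis.

Set Implicit Arguments.
Unset Strict Implicit.
Unset Printing Implicit Defensive.

Import Order.TTheory GRing.Theory Num.Theory.
Import numFieldNormedType.Exports.
Local Open Scope classical_set_scope.
Local Open Scope ring_scope.

Section ContFun.
Context {R : realType} {X : topologicalType} (K : set X).

Definition contfun_pred : {pred K -> R^o} := fun f => `[< continuous f >].

Lemma contfun_submod_closed : submod_closed contfun_pred.
Proof.
split=> [|a f g /asboolP cf /asboolP cg]; apply/asboolP.
  exact: (@cst_continuous K R^o 0).
move=> x; exact: (cvgD (cvgZl_tmp (cf x)) (cg x)).
Qed.

HB.instance Definition _ :=
  GRing.isSubmodClosed.Build R (K -> R^o) contfun_pred contfun_submod_closed.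

(* The proof that K is compact is a parameter of the type because the supremum
   norm below is a norm only on bounded functions. *)
Record contfun (cK : compact K) : Type := ContFun {
  contfun_val :> K -> R^o;
  contfun_valP : contfun_val \in contfun_pred }.

Variable cK : compact K.
Notation C := (contfun cK).

HB.instance Definition _ := [isSub of C for @contfun_val cK].
HB.instance Definition _ := [Choice of C by <:].
HB.instance Definition _ := [SubChoice_isSubLmodule of C by <:].

Lemma contfun_continuous (f : C) : continuous (f : K -> R^o).
Proof. exact/asboolP/(contfun_valP f). Qed.

Lemma contfun_has_ubound (f : C) : has_ubound [set `|f x| | x in [set: K]].
Proof.
have cf : {within K, continuous (valL_ (0 : R^o) f : X -> R^o)}.
  by apply/subspace_sigL_continuousP; rewrite valLK; exact: contfun_continuous.
have /compact_bounded [M [_ HM]] := continuous_compact cf cK.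
exists (M + 1) => _ [x _ <-]; apply: (HM (M + 1)); first by rewrite ltrDl.
exists (set_val x); first exact: set_valP.
by have /(congr1 (fun h => h x)) := @valLK _ _ (0 : R^o) K f.
Qed.

Definition sup_norm (f : C) : R := sup [set `|f x| | x in [set: K]].

Lemma le_sup_norm (f : C) x : `|f x| <= sup_norm f.
Proof. by apply: ub_le_sup; [exact: contfun_has_ubound | exists x]. Qed.

Lemma sup_norm_le (f : C) M :
  0 <= M -> (forall x, `|f x| <= M) -> sup_norm f <= M.
Proof.
move=> M0 fM; rewrite /sup_norm.
have [->|/set0P ne] := eqVneq [set `|f x| | x in [set: K]] set0.
  by rewrite sup0.
by apply: ge_sup => // _ [x _ <-].
Qed.

Lemma sup_norm_ge0 (f : C) : 0 <= sup_norm f.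
Proof.
have [E|/set0P [_ [x _ _]]] := eqVneq [set `|f x| | x in [set: K]] set0.
  by rewrite /sup_norm E sup0.
exact: le_trans (le_sup_norm f x).
Qed.

Lemma ler_sup_normD (f g : C) : sup_norm (f + g) <= sup_norm f + sup_norm g.
Proof.
apply: sup_norm_le => [|x]; first by rewrite addr_ge0 ?sup_norm_ge0.
by apply: le_trans (ler_normD _ _) _; rewrite lerD ?le_sup_norm.
Qed.

Lemma sup_normZ (a : R) (f : C) : sup_norm (a *: f) = `|a| * sup_norm f.
Proof.
have le b (g : C) : sup_norm (b *: g) <= `|b| * sup_norm g.
  apply: sup_norm_le => [|x]; first by rewrite mulr_ge0 ?sup_norm_ge0.
  by rewrite [X in X <= _]normrM ler_wpM2l ?le_sup_norm.
apply/eqP; rewrite eq_le le /=.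
have [->|a0] := eqVneq a 0; first by rewrite normr0 mul0r sup_norm_ge0.
rewrite -ler_pdivlMl ?normr_gt0// -normfV.
by apply: le_trans (le _ _); rewrite scalerA mulVf// scale1r.
Qed.

Lemma sup_norm_eq0 (f : C) : sup_norm f = 0 -> f = 0.
Proof.
move=> f0; apply/val_inj/funext => x; apply/eqP.
by rewrite -normr_le0 -f0 le_sup_norm.
Qed.

HB.instance Definition _ := Lmodule_isNormed.Build R C
  ler_sup_normD sup_normZ sup_norm_eq0.

End ContFun.

Arguments contfun R {X K} cK.

Section Network.
Context {R : realType}.

Definition sigmoidal (sigma : R -> R) : Prop :=
  (sigma z @[z --> +oo] --> (1 : R)) /\ (sigma z @[z --> -oo] --> (0 : R)).

Lemma compact_cylinder d (Omega : set 'cV[R]_d) (T : R) :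
  compact Omega -> compact (Omega `*` `[0%R, T]%classic).
Proof. by move=> cO; apply: compact_setX => //; exact: segment_compact. Qed.

Definition separable_net d (sigma : R -> R) (N : nat) (u : 'I_N -> R)
    (kx : 'I_N -> 'cV[R]_d) (bx kt bt : 'I_N -> R) (p : 'cV[R]_d * R) : R :=
  \sum_(j < N) u j * sigma (((kx j)^T *m p.1) ord0 ord0 + bx j)
                   * sigma (kt j * p.2 + bt j).

(* Elements of C(K) are functions on the subtype K, hence [set_val]. *)
Definition separable_nets d (sigma : R -> R) (K : set ('cV[R]_d * R))
    (cK : compact K) : set (contfun R cK) :=
  [set G | exists (N : nat) (u : 'I_N -> R) (kx : 'I_N -> 'cV[R]_d)
             (bx kt bt : 'I_N -> R),
     (0 < N)%N /\
     forall p : K, G p = separable_net sigma u kx bx kt bt (set_val p)].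

End Network.

Arguments compact_cylinder {R d Omega} T _.
Arguments separable_nets {R d} sigma {K} cK _.

(* Main.v *)
(** The functions exp(k.x + tau t) span an algebra which separates points, so by
Stone-Weierstrass it suffices to approximate each exp(k.x) exp(tau t).  Each
factor is a function of one bounded real variable, hence a uniform limit of
sums of sigmoids (steep sigmoids make up a staircase), and the product of two
such sums is a sum of products of two sigmoids. *)

Require Import Defs.
From HB Require Import structures.
From mathcomp Require Import all_boot all_order all_algebra.
From mathcomp Require Import all_classical all_reals all_analysis.
From mathcomp Require Import ring lra.
Set Implicit Arguments.
Unset Strict Implicit.
Unset Printing Implicit Defensive.

Import Order.TTheory GRing.Theory Num.Theory.
Import numFieldNormedType.Exports.
Local Open Scope classical_set_scope.
Local Open Scope ring_scope.

(** * The Stone-Weierstrass theorem *)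

(** This takes the place of extracting finite subcovers. The sets whose complement in [K] satisfies
    [P] form a filter, and the filter is proper exactly when [P K] fails. *)
Lemma compact_induction {X : topologicalType} (K : set X) (P : set X -> Prop) :
  compact K -> P set0 ->
  (forall U V, U `<=` V -> P V -> P U) ->
  (forall U V, P U -> P V -> P (U `|` V)) ->
  (forall x, K x -> exists2 U, nbhs x U & P U) -> P K.
Proof.
move=> cK P0 PS PU Ploc; apply: contrapT => nPK.
(* A cluster point of this filter contradicts [Ploc]. *)
pose F : set_system X := [set B | P (K `\` B)].
have FE B : F B = P (K `\` B) by [].
have FF : ProperFilter F.
  split; first by rewrite /F /= setD0.
  split=> [|B C|B C BC]; rewrite !FE.
  - by rewrite setDT.
  - by rewrite setDIr; exact: PU.
  - by apply: PS; exact: setDS.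
have [|x [Kx]] := cK F FF; first by rewrite /F /= setDv.
have [U xU PUU] := Ploc x Kx.
have FU : F (~` U) by rewrite /F /= setDE setCK; apply: PS PUU; exact: subIsetr.
by move=> /(_ _ _ FU xU) [z []].
Qed.

Section StoneWeierstrass.
Context {R : realType} {X : topologicalType}.
Implicit Types (A B C : set (X -> R)) (f g : X -> R).

Record unital_subalgebra A : Prop := UnitalSubalgebra {
  subalgebra_cst : forall c, A (cst c);
  subalgebraD : forall f g, A f -> A g -> A (f \+ g);
  subalgebraM : forall f g, A f -> A g -> A (f \* g) }.

(** Continuity is built in so that, on a compact space, members of the closure are bounded, as the
    estimate for products requires. *)
Definition uniform_closure A : set (X -> R) :=
  [set f | continuous f /\
     forall e : R, 0 < e -> exists2 g, A g & forall x, `|f x - g x| <= e].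

Lemma sub_uniform_closure A f : continuous f -> A f -> uniform_closure A f.
Proof.
by move=> cf Af; split=> // e e0; exists f => // x; rewrite subrr normr0 ltW.
Qed.

Lemma uniform_closureS A B :
  A `<=` uniform_closure B -> uniform_closure A `<=` uniform_closure B.
Proof.
move=> AB f [cf Hf]; split=> // e e0.
have e20 : 0 < e / 2 by rewrite divr_gt0.
have [g /AB[_ Hg] fg] := Hf _ e20; have [h Bh gh] := Hg _ e20.
exists h => // x; rewrite [e]splitr (le_trans (ler_distD (g x) _ _))//.
exact: lerD.
Qed.

Lemma uniform_closureD A f g :
  (forall f g, A f -> A g -> A (f \+ g)) ->
  uniform_closure A f -> uniform_closure A g -> uniform_closure A (f \+ g).
Proof.
move=> AD [cf Hf] [cg Hg]; split=> [x|e e0].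
  by apply: cvgD; [exact: cf|exact: cg].
have e20 : 0 < e / 2 by rewrite divr_gt0.
have [f' Af ff] := Hf _ e20; have [g' Ag gg] := Hg _ e20.
exists (f' \+ g'); first exact: AD.
move=> x /=; rewrite opprD addrACA [e]splitr (le_trans (ler_normD _ _))//.
exact: lerD.
Qed.

Hypothesis cX : compact [set: X].

Lemma continuous_bounded f : continuous f ->
  exists2 M, 1 <= M & forall x, `|f x| <= M.
Proof.
move=> cf.
have /compact_bounded [M [_ HM]] : compact (range f).
  by apply: continuous_compact => //; exact: continuous_subspaceT.
exists (`|M| + 1); first by rewrite lerDr.
move=> x; apply: (HM (`|M| + 1)); last by exists x.
by rewrite ltr_pwDr// ler_norm.
Qed.

(** Three separate classes are kept so that sigmoids in space and sigmoids in time can multiply into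
    a third class. *)
Lemma uniform_closureM A B C f g :
  (forall f g, A f -> B g -> C (f \* g)) ->
  uniform_closure A f -> uniform_closure B g -> uniform_closure C (f \* g).
Proof.
move=> ABC [cf Hf] [cg Hg]; split=> [x|e e0].
  by apply: cvgM; [exact: cf|exact: cg].
have [M M1 fM] := continuous_bounded cf.
have [N N1 gN] := continuous_bounded cg.
have MN0 : 0 < M + N + 1 by lra.
(* The product error is at most [d * N + M * d + d * d], which is at most [d * (M + N + 1)] because
   [d <= 1]. *)
have d0 : 0 < Num.min 1 (e / (M + N + 1)) by rewrite lt_min ltr01 divr_gt0.
have [f' Af ff] := Hf _ d0; have [g' Ag gg] := Hg _ d0.
exists (f' \* g'); first exact: ABC.
move=> x /=; move: (ff x) (gg x) (fM x) (gN x).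
set d := Num.min _ _ in d0 *.
have d1 : d <= 1 by rewrite ge_min lexx.
have de : d * (M + N + 1) <= e by rewrite -ler_pdivlMr// ge_min lexx orbT.
move=> fd gd fMx gNx.
have -> : f x * g x - f' x * g' x =
    (f x - f' x) * g x + f x * (g x - g' x) - (f x - f' x) * (g x - g' x).
  by ring.
apply: le_trans de; apply: le_trans (ler_normB _ _) _.
apply: (@le_trans _ _ (d * N + M * d + d * d)); last by nra.
apply: lerD; last by rewrite normrM ler_pM.
apply: le_trans (ler_normD _ _) _.
by rewrite !normrM lerD// ler_pM.
Qed.

Lemma uniform_closureZ A c f : (forall f, A f -> A (cst c \* f)) ->
  uniform_closure A f -> uniform_closure A (cst c \* f).
Proof.
move=> AZ; apply: (@uniform_closureM [set cst c]) => [_ g ->|]; first exact: AZ.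
by apply: sub_uniform_closure => // x; exact: cvg_cst.
Qed.

Lemma uniform_closure_subalgebra A :
  unital_subalgebra A -> unital_subalgebra (uniform_closure A).
Proof.
move=> [A1 AD AM]; split=> [c|f g|f g].
- by apply: sub_uniform_closure => // x; exact: cvg_cst.
- exact: uniform_closureD.
- exact: uniform_closureM.
Qed.

(* Iterates that are polynomials in [x] and increase to [`|x|] on [-1, 1]. *)
Fixpoint abs_approx (n : nat) (x : R) : R :=
  if n is m.+1 then
    let p := abs_approx m x in p + 2^-1 * (x * x - p * p)
  else 0.

(** With [y] for the absolute value of [x], one iteration multiplies the gap [y - p] by
    [1 - (y + p) / 2]. Hence the gap decays like [2 * y / (2 + n * y)], stated here with the
    denominator cleared. *)
Lemma abs_approx_bounds n x : `|x| <= 1 ->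
  0 <= abs_approx n x <= `|x| /\
  (`|x| - abs_approx n x) * (2 + n%:R * `|x|) <= 2 * `|x|.
Proof.
move=> x1; have xx : x * x = `|x| * `|x| by rewrite -normrM ger0_norm ?sqr_ge0.
elim: n => [|n] /=.
  by rewrite subr0 mul0r addr0 lexx normr_ge0; split=> //; lra.
rewrite xx; set p := abs_approx n x; move: (normr_ge0 x) x1.
move: `|x| p => y p y0 y1 [/andP[p0 py] H].
rewrite -[in n.+1%:R]addn1 natrD.
have n0 : 0 <= n%:R :> R by [].
move: (n%:R : R) n0 H => m m0 H.
split; first by apply/andP; split; nra.
apply: le_trans H.
have -> : y - (p + 2^-1 * (y * y - p * p)) = (y - p) * (1 - (y + p) / 2) by field.
rewrite -mulrA ler_wpM2l ?subr_ge0//.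
rewrite (mulrDl m 1) mul1r; move: (m * y) (mulr_ge0 m0 y0) => k k0.
have : 0 <= (y + p) * (k + y) by rewrite mulr_ge0 ?addr_ge0.
lra.
Qed.

Lemma abs_approx_dist n x : `|x| <= 1 ->
  `| `|x| - abs_approx n x| <= 2 / n.+1%:R.
Proof.
case: n => [|n] x1.
  by rewrite subr0 normr_id divr1 (le_trans x1)// ler1n.
have [/andP[p0 px] H] := abs_approx_bounds n.+1 x1.
rewrite ger0_norm ?subr_ge0// ler_pdivlMr ?ltr0n//.
move: H p0 px x1; rewrite -[in n.+2%:R]addn1 natrD.
move: (abs_approx _ x) (n.+1%:R : R) (ler0n R n.+1) (normr_ge0 x) => p m m0.
have [->|] := eqVneq `|x| 0; first by move=> *; have -> : p = 0; lra.
move=> xn0; rewrite le_eqVlt eq_sym (negbTE xn0) /=.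
move: `|x| => y y0 H p0 py y1.
(* After multiplication by [y > 0] the goal follows from [H], since [y <= 1] gives
   [(y - p) * y <= y - p]. *)
rewrite -(ler_pM2l y0).
have : 0 <= (y - p) * (1 - y) by rewrite mulr_ge0 ?subr_ge0.
lra.
Qed.

Lemma subalgebraZ A c f : unital_subalgebra A -> A f -> A (cst c \* f).
Proof. by move=> [A1 _ AM] Af; apply: AM. Qed.

Lemma abs_approx_subalgebra A n f : unital_subalgebra A -> A f ->
  A (abs_approx n \o f).
Proof.
move=> sA Af; have [A1 AD AM] := sA; elim: n => [|n IH]; first exact: A1.
have := AD _ _ IH (AM _ _ (A1 2^-1) (AD _ _ (AM _ _ Af Af)
  (AM _ _ (A1 (-1)) (AM _ _ IH IH)))).
congr A; apply/funext => x /=; ring.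
Qed.

(** Division by a bound [M] brings [f] into [-1, 1], where the iterates converge uniformly. They
    stay in the closure, which is itself a subalgebra, and closing a second time adds nothing. *)
Lemma uniform_closure_norm A f : unital_subalgebra A ->
  uniform_closure A f -> uniform_closure A (fun x => `|f x|).
Proof.
move=> sA clf; have sC := uniform_closure_subalgebra sA.
have [M M1 fM] := continuous_bounded clf.1.
have M0 : 0 < M by lra.
have clh := subalgebraZ M^-1 sC clf.
suff : uniform_closure A (fun x => `|M^-1 * f x|).
  move=> /(subalgebraZ M sC); congr uniform_closure.
  apply/funext => x /=; rewrite normrM gtr0_norm ?invr_gt0// mulrA mulfV ?mul1r//.
  by rewrite gt_eqF.
apply: (@uniform_closureS (uniform_closure A)) => //; split.
  move=> x; apply: (@continuous_comp _ _ _ (cst M^-1 \* f) Num.norm).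
    exact: clh.1.
  exact: norm_continuous.
move=> e e0; have [n ne] : exists n : nat, 2 / n.+1%:R <= e.
  exists (Num.trunc (2 / e)); rewrite ler_pdivrMr ?ltr0n// mulrC -ler_pdivrMr//.
  by rewrite ltW// truncnS_gt.
exists (abs_approx n \o (cst M^-1 \* f)); first exact: abs_approx_subalgebra.
move=> x /=; apply: le_trans ne; apply: abs_approx_dist.
by rewrite normrM gtr0_norm ?invr_gt0// ler_pdivrMl// mulr1.
Qed.

Lemma uniform_closure_max A f g : unital_subalgebra A ->
  uniform_closure A f -> uniform_closure A g ->
  uniform_closure A (fun x => Num.max (f x) (g x)).
Proof.
move=> sA clf clg; have [C1 CD CM] := uniform_closure_subalgebra sA.
have clN := uniform_closure_norm sA (CD _ _ clf (CM _ _ (C1 (-1)) clg)).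
have := CM _ _ (C1 2^-1) (CD _ _ (CD _ _ clf clg) clN).
by congr uniform_closure; apply/funext => x /=; rewrite maxr_absE mulN1r mulrC.
Qed.

Lemma uniform_closure_min A f g : unital_subalgebra A ->
  uniform_closure A f -> uniform_closure A g ->
  uniform_closure A (fun x => Num.min (f x) (g x)).
Proof.
move=> sA clf clg; have [C1 CD CM] := uniform_closure_subalgebra sA.
have clN := uniform_closure_norm sA (CD _ _ clf (CM _ _ (C1 (-1)) clg)).
have := CM _ _ (C1 2^-1) (CD _ _ (CD _ _ clf clg) (CM _ _ (C1 (-1)) clN)).
congr uniform_closure; apply/funext => x /=.
by rewrite minr_absE !mulN1r mulrC.
Qed.

Lemma subalgebra_interpolation A (x y : X) (a b : R) : unital_subalgebra A ->
  (forall x y, x <> y -> exists2 f, A f & f x != f y) ->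
  (x = y -> a = b) -> exists f, [/\ A f, f x = a & f y = b].
Proof.
move=> sA sep; have [A1 AD AM] := sA.
have [<- /(_ erefl) <-|xy _] := pselect (x = y); first by exists (cst a).
have [f Af fxy] := sep _ _ xy.
exists (cst a \+ (cst ((b - a) / (f y - f x)) \* (f \+ cst (- f x)))).
split=> /=; first exact: AD (A1 _) (AM _ _ (A1 _) (AD _ _ Af (A1 _))).
  by rewrite subrr mulr0 addr0.
by rewrite divfK ?subr_eq0 1?eq_sym// addrC subrK.
Qed.

Lemma near_lt_continuous f g x : continuous f -> continuous g -> f x < g x ->
  \forall z \near x, f z < g z.
Proof.
move=> cf cg fg.
have cgf : (g z - f z) @[z --> x] --> g x - f x.
  by apply: cvgB; [exact: cg|exact: cf].
have : \forall z \near x, 0 < g z - f z.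
  by apply: (cvgr_gt (g x - f x) cgf); rewrite subr_gt0.
by apply: filterS => z; rewrite subr_gt0.
Qed.

(** Interpolants of [g] at [y] and [z] stay above [g - e] near [z]; the maximum of finitely many is
    above [g - e] everywhere and still below [g + e] at [y], hence near [y]. The minimum of finitely
    many of these maxima is within [e] of [g]. Both finite selections are made by
    [compact_induction]. *)
Theorem stone_weierstrass A g : unital_subalgebra A ->
  (forall f, A f -> continuous f) ->
  (forall x y, x <> y -> exists2 f, A f & f x != f y) ->
  continuous g -> uniform_closure A g.
Proof.
move=> sA cA sep cg; apply: (@uniform_closureS (uniform_closure A)) => //.
split=> // e e0.
have subC f : A f -> uniform_closure A f.
  by move=> Af; apply: sub_uniform_closure => //; exact: cA.
have cgD c : continuous (fun x => g x + c).
  by move=> x; apply: cvgD; [exact: cg|exact: cvg_cst].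
have above y : exists f, [/\ uniform_closure A f, f y < g y + e &
    forall z, g z + - e < f z].
  pose P U := exists f, [/\ uniform_closure A f, f y < g y + e &
    forall z, U z -> g z + - e < f z].
  suff [f [Af fy fz]] : P [set: X] by exists f; split=> // z; exact: fz.
  apply: (compact_induction cX).
  - exists (cst (g y)); split=> //; last by rewrite /= ltrDl.
    by apply: subC; case: sA.
  - by move=> U V UV [f [Af fy fV]]; exists f; split=> // z /UV /fV.
  - move=> U V [f1 [Af1 fy1 fU]] [f2 [Af2 fy2 fV]].
    exists (fun x => Num.max (f1 x) (f2 x)); split.
    + exact: uniform_closure_max.
    + by rewrite gt_max fy1.
    + by move=> z [/fU|/fV] H; rewrite lt_max H ?orbT.
  move=> z _.
  have [|f [Af fy fz]] := subalgebra_interpolation (x := y) (y := z)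
      (a := g y) (b := g z) sA sep.
    by move->.
  exists [set w | g w + - e < f w]; last first.
    by exists f; split; [exact: subC|rewrite fy ltrDl|].
  by apply: near_lt_continuous => //; [exact: cA|rewrite fz gtrDl oppr_lt0].
pose P U := exists f, [/\ uniform_closure A f, forall z, g z + - e < f z &
  forall z, U z -> f z < g z + e].
suff [f [Af fl fu]] : P [set: X].
  by exists f => // x; rewrite ler_norml; move: (fl x) (fu x I); lra.
apply: (compact_induction cX).
(* The minimum over no function is replaced by a constant above [g - e]. *)
- have [M M1 gM] := continuous_bounded cg.
  exists (cst M); split=> //; first by apply: subC; case: sA.
  by move=> z; rewrite /cst; have := ler_norm (g z); have := gM z; lra.
- by move=> U V UV [f [Af fl fV]]; exists f; split=> // z /UV /fV.
- move=> U V [f1 [Af1 fl1 fU]] [f2 [Af2 fl2 fV]].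
  exists (fun x => Num.min (f1 x) (f2 x)); split.
  + exact: uniform_closure_min.
  + by move=> z; rewrite lt_min fl1 fl2.
  + by move=> z [/fU|/fV] H; rewrite gt_min H ?orbT.
move=> y _; have [f [Af fy fl]] := above y.
exists [set w | f w < g w + e]; last by exists f.
by apply: near_lt_continuous => //; exact: Af.1.
Qed.

End StoneWeierstrass.

(** * Sums of sigmoids in one variable *)

Section LinearSpan.
Context {R : realType} {X : Type}.
Implicit Types (B : set (X -> R)) (f g : X -> R).

(** Building combinations term by term gives closure properties by induction; indexed sums appear
    only when a member of the span is turned into a network. *)
Inductive linear_span B : (X -> R) -> Prop :=
| linear_span0 : linear_span B (cst 0)
| linear_span_cons c b f : B b -> linear_span B f ->
    linear_span B ((cst c \* b) \+ f).

Lemma linear_span_atom B c b : B b -> linear_span B (cst c \* b).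
Proof.
move=> Bb; have := linear_span_cons c Bb (linear_span0 B).
by congr linear_span; apply/funext => x /=; rewrite addr0.
Qed.

Lemma linear_spanD B f g :
  linear_span B f -> linear_span B g -> linear_span B (f \+ g).
Proof.
move=> Bf Bg; elim: Bf => [|c b h Bb _ IH].
  by move: Bg; congr linear_span; apply/funext => x /=; rewrite add0r.
have := linear_span_cons c Bb IH.
by congr linear_span; apply/funext => x /=; rewrite addrA.
Qed.

Lemma linear_spanM B1 B2 B f g :
  (forall b1 b2, B1 b1 -> B2 b2 -> B (b1 \* b2)) ->
  linear_span B1 f -> linear_span B2 g -> linear_span B (f \* g).
Proof.
move=> BM B1f B2g; elim: B1f => [|c b h Bb _ IH].
  have := linear_span0 B.
  by congr linear_span; apply/funext => x /=; rewrite mul0r.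
suff : linear_span B ((cst c \* b) \* g).
  move=> H; have := linear_spanD H IH.
  by congr linear_span; apply/funext => x /=; rewrite mulrDl.
elim: B2g => [|c' b' h' Bb' _ IH'].
  have := linear_span0 B.
  by congr linear_span; apply/funext => x /=; rewrite mulr0.
have := linear_span_cons (c * c') (BM _ _ Bb Bb') IH'.
by congr linear_span; apply/funext => x /=; rewrite mulrDr mulrACA.
Qed.

Lemma linear_span_scale B c f : linear_span B f -> linear_span B (cst c \* f).
Proof.
elim=> [|c' b g Bb _ IH].
  have := linear_span0 B.
  by congr linear_span; apply/funext => x /=; rewrite mulr0.
have := linear_span_cons (c * c') Bb IH.
by congr linear_span; apply/funext => x /=; rewrite mulrDr mulrA.
Qed.

End LinearSpan.

Lemma linear_span_comp {R : realType} {X Y : Type} (B : set (X -> R))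
    (B' : set (Y -> R)) (l : Y -> X) f :
  (forall b, B b -> B' (b \o l)) -> linear_span B f -> linear_span B' (f \o l).
Proof.
move=> BB'; elim=> [|c b h Bb _ IH]; first exact: linear_span0.
exact: linear_span_cons (BB' _ Bb) IH.
Qed.

Lemma linear_span_continuous {R : realType} {X : topologicalType}
    (B : set (X -> R)) f :
  (forall b, B b -> continuous b) -> linear_span B f -> continuous f.
Proof.
move=> cB; elim=> [x|c b h Bb _ IH x]; first exact: cvg_cst.
by apply: cvgD; [apply: cvgM; [exact: cvg_cst|exact: cB]|exact: IH].
Qed.

Lemma linear_span_sub_closure {R : realType} {X : topologicalType}
    (B B' : set (X -> R)) :
  (forall b c, B b -> uniform_closure (linear_span B') (cst c \* b)) ->
  linear_span B `<=` uniform_closure (linear_span B').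
Proof.
move=> BB' _ [|c b f Bb Bf].
  by apply: sub_uniform_closure; [move=> x; exact: cvg_cst|exact: linear_span0].
elim: Bf c b Bb => [|c' b' f' Bb' _ IH] c b Bb.
  by have := BB' _ c Bb; congr uniform_closure; apply/funext => x /=; rewrite addr0.
by apply: uniform_closureD; [exact: linear_spanD|exact: BB'|exact: IH].
Qed.

Section Sigmoidal.
Context {R : realType}.
Variable sigma : R -> R.
Hypotheses (sigma_cont : continuous sigma) (sigma_sigm : sigmoidal sigma).

Lemma sigmoidal_tails (e : R) : 0 < e -> exists2 M, 0 < M &
  forall z, (M <= z -> `|sigma z - 1| <= e) /\ (z <= - M -> `|sigma z| <= e).
Proof.
move=> e0; have [/cvgrPdist_le/(_ _ e0)[M1 [_ HM1]]] := sigma_sigm.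
move=> /cvgrPdist_le/(_ _ e0)[M2 [_ HM2]].
(* The extra 1 makes the threshold positive and places it strictly beyond [M1] and [M2], as
   neighbourhoods of infinity demand. *)
exists (`|M1| + `|M2| + 1); first by rewrite ltr_wpDl ?addr_ge0.
move=> z; have := ler_norm M1; have := ler_norm (- M2).
rewrite normrN => M2M M1M; have := normr_ge0 M1; have := normr_ge0 M2.
move=> p1 p2; split=> Mz.
  by rewrite distrC; apply: HM1; lra.
by rewrite -normrN -sub0r; apply: HM2; lra.
Qed.

Lemma sigmoidal_bounded : exists2 B, 0 < B & forall z, `|sigma z| <= B.
Proof.
have [M M0 HM] := sigmoidal_tails ltr01.
have /compact_bounded [B [_ HB]] : compact (sigma @` `[- M, M]).
  apply: continuous_compact; last exact: segment_compact.
  exact: continuous_subspaceT.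
have B0 := normr_ge0 B; have BB := ler_norm B.
(* The tails give at most 2 on the right and 1 on the left; on the middle segment the bound must
   exceed [B] strictly. *)
exists (`|B| + 2); first lra.
move=> z; have [H1 H2] := HM z.
have [/H1|zM] := leP M z; first by rewrite !ler_norml; lra.
have [/H2|Mz] := leP z (- M); first by lra.
apply: (HB (`|B| + 2)); first lra.
by exists z => //=; rewrite in_itv /= !ltW.
Qed.

Definition sigmoidal_atoms : set (R -> R) :=
  [set s | exists k b, s = fun z => sigma (k * z + b)].

(** An atom of slope 0 is constant, and far to the right [sigma] is within 1/2 of 1, hence nonzero,
    so it can be rescaled. *)
Lemma sigmoidal_span_cst c : linear_span sigmoidal_atoms (cst c).
Proof.
have h0 : (0 : R) < 2^-1 by rewrite invr_gt0.
have [M _ /(_ M) [/(_ (lexx _)) HM _]] := sigmoidal_tails h0.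
have sM : sigma M != 0.
  by apply/eqP => sM0; move: HM; rewrite sM0 sub0r normrN1; lra.
have : sigmoidal_atoms (fun z => sigma (0 * z + M)) by exists 0, M.
move=> /(linear_span_atom (c / sigma M)); congr linear_span.
by apply/funext => z /=; rewrite mul0r add0r divfK.
Qed.

(* [f] is a sum of steep sigmoids, each climbing by the increment of [g] over
   one cell of length [h] and centred at the midpoint of that cell. *)
Lemma sigmoidal_staircase (g : R -> R) (a h w d k B : R) (n : nat) :
  0 < h -> 0 <= w -> 0 <= d -> (forall z, `|sigma z| <= B) ->
  (forall y, (h / 2 <= y -> `|sigma (k * y) - 1| <= d) /\
             (y <= - (h / 2) -> `|sigma (k * y)| <= d)) ->
  (forall x y, a <= x -> x <= y -> y <= x + h -> y <= a + n%:R * h ->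
     `|g y - g x| <= w) ->
  exists f, [/\ linear_span sigmoidal_atoms f,
    forall x, a <= x <= a + n%:R * h ->
      `|g x - f x| <= n%:R * (w * d) + w * (1 + B) &
    forall x, a + n%:R * h <= x ->
      `|g (a + n%:R * h) - f x| <= n%:R * (w * d)].
Proof.
move=> h0 w0 d0 sB kd.
have B0 : 0 <= B by apply: le_trans (sB 0).
(* Each step costs at most [w * d] away from its own cell; the cost [w * (1 + B)] is paid only once,
   for the cell containing [x]. The estimate to the right of the last node is what the next cell
   starts from. *)
elim: n => [|n IH] gw.
  exists (cst (g a)); split; first exact: sigmoidal_span_cst.
    move=> x; rewrite mul0r addr0 => /le_anti <-; rewrite subrr normr0 mul0r add0r.
    by rewrite mulr_ge0 ?addr_ge0.
  by move=> x _; rewrite !mul0r addr0 subrr normr0.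
have nS : n.+1%:R = n%:R + 1 :> R by rewrite -addn1 natrD.
have [|f [Bf f1 f2]] := IH.
  by move=> x y ax xy yx yn; apply: gw => //; rewrite nS; lra.
have n0 : 0 <= n%:R * h by rewrite mulr_ge0// ltW.
move: gw f1 f2 n0; rewrite nS mulrDl mul1r; move: (n%:R * h) => nh gw f1 f2 n0.
set D := g (a + (nh + h)) - g (a + nh).
have DW : `|D| <= w by apply: gw; lra.
pose m := a + nh + h / 2.
have mE x : k * x + - (k * m) = k * (x - m) by rewrite mulrBr.
exists ((cst D \* (fun z => sigma (k * z + - (k * m)))) \+ f); split.
- by apply: linear_span_cons => //; exists k, (- (k * m)).
- move=> x /andP[ax xn]; rewrite /= mE (mulrDl _ 1) mul1r opprD [- _ - _]addrC addrA.
  (* To the left of the new cell the new sigmoid is at most [d] in size. *)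
  have [xl|xg] := leP x (a + nh).
    have fx : `|g x - f x| <= n%:R * (w * d) + w * (1 + B).
      by apply: f1; rewrite ax.
    have Ds : `|D * sigma (k * (x - m))| <= w * d.
      by rewrite normrM ler_pM//; apply: (kd _).2; rewrite /m; lra.
    by apply: le_trans (ler_normB _ _) _; lra.
  (* Inside the new cell only the bound [B] on the new sigmoid is available, and [g] has moved by at
     most [w]. *)
  have fx : `|g (a + nh) - f x| <= n%:R * (w * d) by apply: f2; exact: ltW.
  have gx : `|g x - g (a + nh)| <= w by apply: gw; lra.
  have Ds : `|D * sigma (k * (x - m))| <= w * B by rewrite normrM ler_pM.
  rewrite (_ : g x - f x = (g x - g (a + nh)) + (g (a + nh) - f x)); last by ring.
  apply: le_trans (ler_normB _ _) _.
  apply: (@le_trans _ _ (w + n%:R * (w * d) + w * B)).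
    by rewrite lerD// (le_trans (ler_normD _ _))// lerD.
  have : 0 <= w * d by rewrite mulr_ge0.
  lra.
- move=> x xn; rewrite /= mE (mulrDl _ 1) mul1r.
  have fx : `|g (a + nh) - f x| <= n%:R * (w * d) by apply: f2; lra.
  have Ds : `|D * (sigma (k * (x - m)) - 1)| <= w * d.
    by rewrite normrM ler_pM//; apply: (kd _).1; rewrite /m; lra.
  rewrite (_ : g (a + (nh + h)) - _ =
    (g (a + nh) - f x) - D * (sigma (k * (x - m)) - 1)); last by rewrite /D; ring.
  by apply: le_trans (ler_normB _ _) _; rewrite lerD.
Qed.

Lemma sigmoidal_lipschitz_approx (g : R -> R) (a b L e : R) :
  0 < L -> 0 < e -> a < b ->
  (forall x y, a <= x -> x <= y -> y <= b -> `|g y - g x| <= L * (y - x)) ->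
  exists2 f, linear_span sigmoidal_atoms f &
    forall x, a <= x <= b -> `|g x - f x| <= e.
Proof.
move=> L0 e0 ab gL.
have [B B0 sB] := sigmoidal_bounded.
have ba0 : 0 < b - a by rewrite subr_gt0.
(* Each cell has oscillation at most [w = L * h]. Taking [n >= q] makes [w * (1 + B)] at most
   [e / 2]. The tail errors total [L * (b - a) * d], whatever [n] is, and [d] below makes this
   [e / 2]. The slope comes last: it sends half a cell to the threshold [M]. *)
pose q := L * (b - a) * (1 + B) * 2 / e.
have [n n0 qn] : exists2 n : nat, 0 < n%:R :> R & q <= n%:R.
  by exists (Num.trunc q).+1; rewrite ?ltr0n// ltW// truncnS_gt.
pose h := (b - a) / n%:R.
have h0 : 0 < h by rewrite divr_gt0.
have nh : n%:R * h = b - a by rewrite mulrC divfK ?gt_eqF.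
pose d := e / (2 * L * (b - a)).
have d0 : 0 < d by rewrite divr_gt0// !mulr_gt0.
have [M M0 HM] := sigmoidal_tails d0.
have h20 : 0 < h / 2 by rewrite divr_gt0.
have k0 : 0 < M / (h / 2) by rewrite divr_gt0.
have [||||||f [Bf f1 _]] :=
    @sigmoidal_staircase g a h (L * h) d (M / (h / 2)) B n => //.
- by rewrite mulr_ge0// ltW.
- exact: ltW.
- move=> y; split=> hy; [apply: (HM _).1|apply: (HM _).2].
    by rewrite -[leLHS](@divfK _ (h / 2)) ?gt_eqF// ler_pM2l.
  by rewrite -[in - M](@divfK _ (h / 2) _ M) ?gt_eqF// -mulrN ler_pM2l.
- move=> x y ax xy yx; rewrite nh => yb.
  apply: le_trans (gL _ _ ax xy _) _; first lra.
  by rewrite ler_pM2l//; lra.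
exists f => // x xab; apply: le_trans (f1 x _) _; first by rewrite nh addrC subrK.
have -> : n%:R * (L * h * d) = e / 2.
  rewrite (_ : n%:R * (L * h * d) = L * (n%:R * h) * d); last by ring.
  by rewrite nh /d; field; rewrite !gt_eqF.
rewrite [leRHS]splitr lerD2l.
rewrite (_ : L * h * (1 + B) = L * (b - a) * (1 + B) / n%:R); last first.
  by rewrite /h; ring.
by move: qn; rewrite /q !ler_pdivrMr//; lra.
Qed.

(** The exponential is Lipschitz on the bounded range of [l]. The class [S] is left abstract to
    serve both the space and the time factor. *)
Lemma uniform_closure_sigmoidal_expR {X : topologicalType} (S : set (X -> R))
    (l : X -> R) : compact [set: X] -> continuous l ->
  (forall k b, S (fun x => sigma (k * l x + b))) ->
  uniform_closure (linear_span S) (expR \o l).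
Proof.
move=> cX cl HS; split.
  by move=> x; apply: continuous_comp; [exact: cl|exact: continuous_expR].
move=> e e0; have [M M1 lM] := continuous_bounded cX cl.
have [||||f Sf fl] := @sigmoidal_lipschitz_approx expR (- M) M (expR M) e => //.
- exact: expR_gt0.
- lra.
- move=> x y _ xy yM; rewrite ger0_norm ?subr_ge0 ?ler_expR//.
  (* The Lipschitz constant [expR M] comes from [1 + u <= expR u] at [u = x - y]. *)
  have E : expR x = expR y * expR (x - y) by rewrite -expRD addrC subrK.
  have y0 := expR_gt0 y; have yM' : expR y <= expR M by rewrite ler_expR.
  have d1 := expR_ge1Dx (x - y).
  apply: (@le_trans _ _ (expR y * (y - x))); last by rewrite ler_wpM2r// subr_ge0.
  rewrite E -[X in X - _]mulr1 -mulrBr ler_pM2l//; lra.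
exists (f \o l).
  by apply: linear_span_comp Sf => _ [k [b ->]]; exact: HS.
by move=> x; apply: fl; rewrite -ler_norml.
Qed.

End Sigmoidal.

(** * Separable networks on a compact set *)

(** A filter on the subtype is pushed forward by [set_val]; its cluster point in [K] lifts back
    because open sets of the subtype are traces of open sets of [X]. *)
Lemma compact_set_type {X : topologicalType} (K : set X) :
  compact K -> compact [set: K].
Proof.
move=> cK F FF _; have FK : (set_val @ F) K.
  by apply: (@filterS _ F _ setT); [move=> y _; exact: set_valP|exact: filterT].
have [x [Kx Fx]] := cK (set_val @ F) _ FK.
exists (SigSub (mem_set Kx)); split=> // A B FA.
move=> [_ [[U oU <-] Ux UB]].
have FvA : (set_val @ F) (set_val @` A).
  by apply: (@filterS _ F _ A) => // a Aa; exists a.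
have [_ [[a Aa <-] Ua]] := Fx _ U FvA (open_nbhs_nbhs (conj oU Ux)).
by exists a; split=> //; exact: UB.
Qed.

Section Cylinder.
Context {R : realType} {d : nat}.
Variable K : set ('cV[R]_d * R).
Hypothesis cK : compact K.

Definition ridge (k : 'cV[R]_d) (p : K) : R := (k^T *m (set_val p).1) ord0 ord0.

Definition time (p : K) : R := (set_val p).2.

Lemma ridgeE k p : ridge k p = \sum_i k i ord0 * (set_val p).1 i ord0.
Proof. by rewrite /ridge mxE; apply: eq_bigr => i _; rewrite mxE. Qed.

Lemma ridge0 : ridge 0 = cst 0.
Proof. by apply/funext => p; rewrite /ridge trmx0 mul0mx mxE. Qed.

Lemma ridgeD k l p : ridge (k + l) p = ridge k p + ridge l p.
Proof. by rewrite /ridge linearD mulmxDl mxE. Qed.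

Lemma ridgeZ c k p : ridge (c *: k) p = c * ridge k p.
Proof. by rewrite /ridge linearZ -scalemxAl mxE. Qed.

Lemma continuous_set_val : continuous (set_val : K -> 'cV[R]_d * R).
Proof. exact: initial_continuous. Qed.

Lemma continuous_time : continuous time.
Proof.
move=> p; apply: (@continuous_comp _ _ _ set_val snd).
  exact: continuous_set_val.
exact: cvg_snd.
Qed.

Lemma continuous_ridge k : continuous (ridge k).
Proof.
rewrite (_ : ridge k = fun p => \sum_i k i ord0 * (set_val p).1 i ord0); last first.
  by apply/funext => p; exact: ridgeE.
apply: (@continuous_big R^o 'I_d +%R 0 predT (@add_continuous R^o) K _
  (fun i (p : K) => k i ord0 * (set_val p).1 i ord0 : R^o)) => i _ p.
apply: (cvgM (F := nbhs p)); first exact: cvg_cst.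
apply: (@continuous_comp _ _ _ (fst \o set_val) (fun M : 'cV[R]_d => M i ord0)).
  apply: continuous_comp; [exact: continuous_set_val|exact: cvg_fst].
exact: coord_continuous.
Qed.

Definition exp_atoms : set (K -> R) :=
  [set f | exists k t, f = expR \o (ridge k \+ (cst t \* time))].

(** Products of exponentials are exponentials of sums, so the linear span is already an algebra. *)
Lemma exp_atoms_subalgebra : unital_subalgebra (linear_span exp_atoms).
Proof.
split=> [c|f g|f g].
- have : exp_atoms (cst 1).
    by exists 0, 0; apply/funext => p /=; rewrite ridge0 mul0r addr0 expR0.
  move=> /(linear_span_atom c); congr linear_span.
  by apply/funext => p /=; rewrite mulr1.
- exact: linear_spanD.
- apply: linear_spanM => _ _ [k [s ->]] [l [t ->]].
  exists (k + l), (s + t); apply/funext => p /=.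
  by rewrite -expRD ridgeD mulrDl addrACA.
Qed.

Lemma exp_atoms_continuous f : exp_atoms f -> continuous f.
Proof.
move=> [k [t ->]] p; apply: continuous_comp; last exact: continuous_expR.
apply: (cvgD (F := nbhs p)); first exact: continuous_ridge.
by apply: (cvgM (F := nbhs p)); [exact: cvg_cst|exact: continuous_time].
Qed.

(** Since [expR] is injective, a separating linear form suffices: time itself, or a space coordinate
    when the times agree. *)
Lemma exp_atoms_separate (p q : K) : p <> q ->
  exists2 f, linear_span exp_atoms f & f p != f q.
Proof.
move=> pq.
have span1 k t : linear_span exp_atoms (expR \o (ridge k \+ (cst t \* time))).
  have : exp_atoms (expR \o (ridge k \+ (cst t \* time))) by exists k, t.
  move=> /(linear_span_atom 1); congr linear_span.
  by apply/funext => r /=; rewrite mul1r.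
suff [k [t kt]] : exists k t, ridge k p + t * time p != ridge k q + t * time q.
  exists (expR \o (ridge k \+ (cst t \* time))); first exact: span1.
  by rewrite /= (inj_eq (@expR_inj R)).
have [tpq|tpq] := eqVneq (time p) (time q); last first.
  by exists 0, 1; rewrite ridge0 !add0r !mul1r.
have [i xi] : exists i, (set_val p).1 i ord0 != (set_val q).1 i ord0.
  apply: contrapT => /forallNP H; apply: pq; apply: val_inj.
  rewrite [LHS]surjective_pairing [RHS]surjective_pairing.
  congr (_, _); last exact: tpq.
  by apply/colP => i; apply/eqP; have /negP := H i; rewrite negbK.
exists (delta_mx i ord0), 0; rewrite !mul0r !addr0.
have E r : ridge (delta_mx i ord0) r = (set_val r).1 i ord0.
  rewrite ridgeE (bigD1 i)//= big1 ?addr0 => [|j ji].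
    by rewrite mxE !eqxx mul1r.
  by rewrite mxE (negbTE ji) mul0r.
by rewrite !E.
Qed.

Lemma exp_span_dense (g : K -> R) : continuous g ->
  uniform_closure (linear_span exp_atoms) g.
Proof.
apply: stone_weierstrass => //.
- exact: compact_set_type.
- exact: exp_atoms_subalgebra.
- by move=> f; apply: linear_span_continuous; exact: exp_atoms_continuous.
- exact: exp_atoms_separate.
Qed.

Variable sigma : R -> R.

Definition net_atoms : set (K -> R) :=
  [set f | exists k b t c,
    f = fun p => sigma (ridge k p + b) * sigma (t * time p + c)].

Lemma separable_net_linear_span f : linear_span net_atoms f ->
  exists N (u : 'I_N.+1 -> R) (kx : 'I_N.+1 -> 'cV[R]_d)
    (bx kt bt : 'I_N.+1 -> R),
  forall p : K, f p = separable_net sigma u kx bx kt bt (set_val p).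
Proof.
elim=> [|c _ g [k [b [t [b' ->]]]] _ [N [u [kx [bx [kt [bt IH]]]]]]].
  (* A network has at least one term, so the empty combination becomes a single term with
     coefficient 0. *)
  exists 0, (cst 0), (cst 0), (cst 0), (cst 0), (cst 0) => p.
  by rewrite /separable_net big1// => i _; rewrite !mul0r.
(* [ext] puts [x] at index 0 and shifts the family [y] by one. *)
pose ext T (x : T) (y : 'I_N.+1 -> T) i := oapp y x (unlift ord0 i).
exists N.+1, (ext _ c u), (ext _ k kx), (ext _ b bx), (ext _ t kt), (ext _ b' bt).
move=> p.
rewrite /separable_net big_ord_recl /ext unlift_none /= IH mulrA; congr (_ + _).
by apply: eq_bigr => i _; rewrite liftK.
Qed.

Hypotheses (sigma_cont : continuous sigma) (sigma_sigm : sigmoidal sigma).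

Lemma net_atoms_continuous f : net_atoms f -> continuous f.
Proof.
move=> [k [b [t [c ->]]]] p; apply: (cvgM (F := nbhs p)).
  apply: continuous_comp; last exact: sigma_cont.
  by apply: (cvgD (F := nbhs p)); [exact: continuous_ridge|exact: cvg_cst].
apply: continuous_comp; last exact: sigma_cont.
apply: (cvgD (F := nbhs p)); last exact: cvg_cst.
by apply: (cvgM (F := nbhs p)); [exact: cvg_cst|exact: continuous_time].
Qed.

Lemma exp_span_sub_net_closure :
  linear_span exp_atoms `<=` uniform_closure (linear_span net_atoms).
Proof.
apply: linear_span_sub_closure => _ c [k [t ->]].
pose Sx : set (K -> R) := [set f | exists k b, f = fun p => sigma (ridge k p + b)].
pose St : set (K -> R) := [set f | exists k b, f = fun p => sigma (k * time p + b)].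
have cKK := compact_set_type cK.
have cx : uniform_closure (linear_span Sx) (expR \o ridge k).
  apply: (uniform_closure_sigmoidal_expR sigma_cont) => //.
    exact: continuous_ridge.
  (* The slope of the one-variable sigmoid is absorbed into the weight vector. *)
  move=> s b; exists (s *: k), b.
  by apply/funext => p; rewrite ridgeZ.
have ct : uniform_closure (linear_span St) (expR \o (cst t \* time)).
  apply: (uniform_closure_sigmoidal_expR sigma_cont) => //.
    by move=> p; apply: (cvgM (F := nbhs p)); [exact: cvg_cst|exact: continuous_time].
  by move=> s b; exists (s * t), b; apply/funext => p /=; rewrite mulrA.
have Sxt : forall f g, linear_span Sx f -> linear_span St g ->
    linear_span net_atoms (f \* g).
  move=> f g; apply: linear_spanM => _ _ [k1 [b ->]] [k2 [b' ->]].
  by exists k1, b, k2, b'.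
have := uniform_closureZ cKK (linear_span_scale c) (uniform_closureM cKK Sxt cx ct).
congr uniform_closure; apply/funext => p /=.
by rewrite expRD.
Qed.

Lemma dense_separable_nets : dense (separable_nets sigma cK).
Proof.
move=> O [G OG] oO.
have /nbhs_ballP[e /= e0 eO] : nbhs G O by apply: open_nbhs_nbhs.
have [_ H] := uniform_closureS exp_span_sub_net_closure
  (exp_span_dense (contfun_continuous (f := G))).
(* The supremum bound is non-strict while the ball is open, hence the half. *)
have e20 : 0 < e / 2 by rewrite divr_gt0.
have [g Ng Gg] := H _ e20.
have cg : (g : K -> R^o) \in @contfun_pred R _ K.
  apply/asboolP; exact: (linear_span_continuous net_atoms_continuous Ng).
exists (@ContFun _ _ _ cK g cg); split.
  apply: eO; rewrite -ball_normE /=.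
  apply: (@le_lt_trans _ _ (e / 2)); last by lra.
  by apply: sup_norm_le; [exact: ltW|exact: Gg].
have [N [u [kx [bx [kt [bt gE]]]]]] := separable_net_linear_span Ng.
by exists N.+1, u, kx, bx, kt, bt.
Qed.

End Cylinder.

Theorem mainTheorem2 (R : realType) (dx : nat) (dx_ge1 : (1 <= dx)%N)
    (Omega : set 'cV[R]_dx) (cOmega : compact Omega) (T : R) (T_gt0 : 0 < T)
    (sigma : R -> R) (sigma_cont : continuous sigma)
    (sigma_sigm : sigmoidal sigma) :
  dense (separable_nets sigma (compact_cylinder T cOmega)).
Proof. exact: dense_separable_nets. Qed.
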